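(* Let $a\in\widetilde V$, $b\in V$ and $s\in\mathbb R$. For every sufficiently decaying function $g=g(x,y,\xi,\eta,u)$ (a superfunction of the field depending also on the real variables $u$; in particular it may be a function of $z$ and $u$) such that the expectations exist, the following two identities hold: $$\left\langle \frac{z_a}{z_\delta}\int g\,\nu_a^{\widetilde W,z}(du)\right\rangle_{\widetilde W,\Phi_\delta=\theta_s0}=\int \llbracket g\rrbracket_{\widetilde A^u,\Psi_\delta=\theta_s0}\;\nu_a^{\widetilde W,1}(du),$$ $$\left\langle \int g\,\nu_b^{W,z}(du)\right\rangle_{W,\Phi_b=\theta_s0}=\int \llbracket g\rrbracket_{A^u,\Psi_b=\theta_s0}\;\nu_b^{W,1}(du).$$ Here $\theta_s0=(\sinh s,0,\cosh s,0,0)$ in the hyperbolic brackets $\langle\cdot\rangle$ and $\theta_s0=(\sinh s,0,0,0)$ in the free-field brackets $\llbracket\cdot\rrbracket$.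
   Context: **Graphs.** $\mathcal G=(V,E)$ is a finite connected non-oriented graph with weights $W_{i,j}=W_{j,i}>0$ on edges and $W_{i,j}=0$ if $\{i,j\}\notin E$. Add a cemetery point $\delta$: $\widetilde V=V\cup\{\delta\}$, with weights $W_{\delta,i}\ge 0$, at least one positive, $\widetilde E=E\cup\{\{\delta,i\}:W_{\delta,i}>0\}$; the weights on $\widetilde{\mathcal G}=(\widetilde V,\widetilde E)$ are denoted $\widetilde W$. **Superfunctions and integration.** To each vertex $i$ are attached real variables $x_i,y_i$ and Grassmann variables $\xi_i,\eta_i$ (all Grassmann variables anticommute). A superfunction is a polynomial in the Grassmann variables whose coefficients are smooth functions of the real variables; a smooth function of even superfunctions is defined by Taylor expansion in the nilpotent parts. Set $$z_i=\sqrt{1+x_i^2+y_i^2+2\xi_i\eta_i}=\sqrt{1+x_i^2+y_i^2}+\frac{\xi_i\eta_i}{\sqrt{1+x_i^2+y_i^2}} .$$ Integration against $\prod_i dx_idy_id\xi_id\eta_i$ means Berezin integration in the Grassmann variables followed by Lebesgue integration, with the sign normalized so that $\int e^{-\sum_{i,j}\xi_iA_{ij}\eta_j}\prod_i d\xi_id\eta_i=\det A$ (i.e. $d\xi_i d\eta_i$ acts as $\partial_{\xi_i}\partial_{\eta_i}$). An indicator such as $\mathds 1_{\Phi_\delta=p}$ means that the variables at that vertex are replaced by the values $p$. ''The expectations exist'' means that the integrals involved converge absolutely. **Hyperbolic field ($H^{2|2}$).** $\Phi_i=(x_i,y_i,z_i,\xi_i,\eta_i)$, $\Phi_i\cdot\Phi_j=x_ix_j+y_iy_j-z_iz_j+\xi_i\eta_j+\xi_j\eta_i$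 and, for $U\subset \widetilde V$, $D\mu_U(\Phi)=\prod_{i\in U}\frac{1}{2\pi z_i}dx_idy_id\xi_id\eta_i$. Define $$\langle F\rangle_{\widetilde W,\Phi_\delta=\theta_s0}=\int F\,\mathds 1_{\Phi_\delta=\theta_s0}\,e^{\sum_{\{i,j\}\in\widetilde E}W_{i,j}(\Phi_i\cdot\Phi_j+1)}D\mu_V(\Phi),$$ $$\langle F\rangle_{W,\Phi_b=\theta_s0}=\int F\,\mathds 1_{\Phi_b=\theta_s0}\,e^{\sum_{\{i,j\}\in E}W_{i,j}(\Phi_i\cdot\Phi_j+1)}D\mu_{V\setminus\{b\}}(\Phi).$$ **Free field.** $\Psi_i=(x_i,y_i,\xi_i,\eta_i)$, $\Psi_i\Psi_j=x_ix_j+y_iy_j+\xi_i\eta_j+\xi_j\eta_i$. For real $u=(u_i)$ let $\widetilde A^u$ be the $\widetilde V\times\widetilde V$ matrix with $\widetilde A^u_{i,j}=-W_{i,j}$ for $i\ne j$ and $\widetilde A^u_{i,i}=\sum_{k\in\widetilde V\setminus\{i\}}W_{i,k}e^{u_k-u_i}$, and let $A^u$ be the $V\times V$ matrix with $A^u_{i,j}=-W_{i,j}$ for $i\neq j$ and $A^u_{i,i}=\sum_{k\in V\setminus\{i\}}W_{i,k}e^{u_k-u_i}$. Define $$\llbracket F\rrbracket_{\widetilde A^u,\Psi_\delta=\theta_s0}=\int F\,\mathds 1_{\Psi_\delta=\theta_s0}\,e^{-\frac12\sum_{i,j\in\widetilde V}\widetilde A^u_{i,j}\Psi_i\Psi_j}\prod_{i\in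 V}\frac{dx_idy_id\xi_id\eta_i}{2\pi},$$ $$\llbracket F\rrbracket_{A^u,\Psi_b=\theta_s0}=\int F\,\mathds 1_{\Psi_b=\theta_s0}\,e^{-\frac12\sum_{i,j\in V}A^u_{i,j}\Psi_i\Psi_j}\prod_{i\in V\setminus\{b\}}\frac{dx_idy_id\xi_id\eta_i}{2\pi}.$$ In the free-field brackets $z_i$ still denotes $\sqrt{1+x_i^2+y_i^2+2\xi_i\eta_i}$ (so $z_\delta=\cosh s$, resp. $z_b=\cosh s$). **Mixing measures.** For $z\in\mathbb R_{>0}^{V}$ and $i_0\in V$, $$\nu_{i_0}^{W,z}(du)=\mathds 1_{u_{i_0}=0}\,e^{-\frac12\sum_{\{i,j\}\in E}W_{i,j}(e^{u_i-u_j}z_j^2+e^{u_j-u_i}z_i^2-2z_iz_j)}\sqrt{D(W,u)}\prod_{i\in V\setminus\{i_0\}}\frac{z_ie^{-u_i}}{\sqrt{2\pi}}du_i,$$ with $D(W,u)=\sum_T\prod_{\{i,j\}\in T}W_{i,j}e^{u_i+u_j}$, the sum being over spanning trees $T$ of $\mathcal G$. For $i_0\in\widetilde V$ and $z\in\mathbb R_{>0}^{\widetilde V}$, $\nu_{i_0}^{\widetilde W,z}(du)$ is defined by the same formula on $\widetilde{\mathcal G}$ (with $V,E$ replaced by $\widetilde V,\widetilde E$ and spanning trees of $\widetilde{\mathcal G}$). The superscript $1$ means $z_i=1$ for all $i$. When $z$ is the superfunction above, the density is understood as a superfunction via Taylor expansion. *)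

(* Defs.v *)
From HB Require Import structures.
From mathcomp Require Import all_boot all_order all_algebra.
From mathcomp Require Import ring.
Set Implicit Arguments.
Unset Strict Implicit.
Unset Printing Implicit Defensive.
Import Order.TTheory GRing.Theory Num.Theory.
Local Open Scope ring_scope.

(** For [a : grassmann R G] and [S : {set G}], [a S] is the coefficient of the
  monomial [e_S], the product of the generators in [S] taken in increasing
  [enum_rank] order. *)
Definition grassmann (R : nzRingType) (G : finType) := {ffun {set G} -> R^o}.

Section Grassmann.
Variables (R : comNzRingType) (G : finType).
Local Notation grassmann := (grassmann R G).
Implicit Types (A B C D S : {set G}) (a b c : grassmann).

#[warnings="-redundant-canonical-projection"]
HB.instance Definition _ :=
  GRing.Lmodule.copy grassmann {ffun {set G} -> R^o}.

Definition inversions A B : nat :=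
  (\sum_(g in A) \sum_(h in B) (enum_rank h < enum_rank g))%N.

(** For disjoint [A] and [B], [e_A * e_B = gsign A B *: e_(A :|: B)]. *)
Definition gsign A B : R := (-1) ^+ inversions A B.

Definition gmul a b : grassmann :=
  [ffun S : {set G} => \sum_(A in powerset S) gsign A (S :\: A) * a A * b (S :\: A)].

Definition gone : grassmann := [ffun S : {set G} => (S == set0)%:R].

Lemma gsign0l B : gsign set0 B = 1.
Proof. by rewrite /gsign /inversions big_set0. Qed.

Lemma gsign0r A : gsign A set0 = 1.
Proof. by rewrite /gsign /inversions big1 // => i _; rewrite big_set0. Qed.

Lemma sum_setU A B (F : G -> nat) : [disjoint A & B] ->
  (\sum_(g in A :|: B) F g = \sum_(g in A) F g + \sum_(g in B) F g)%N.
Proof. by move=> dAB; rewrite -bigU //; apply: eq_bigl => g; rewrite !inE. Qed.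

Lemma gsignUl A B C : [disjoint A & B] ->
  gsign (A :|: B) C = gsign A C * gsign B C.
Proof. by move=> dAB; rewrite /gsign -exprD /inversions sum_setU. Qed.

Lemma gsignUr A B C : [disjoint B & C] ->
  gsign A (B :|: C) = gsign A B * gsign A C.
Proof.
move=> dBC; rewrite /gsign -exprD /inversions -big_split /=; congr (_ ^+ _).
by apply: eq_bigr => g _; rewrite sum_setU.
Qed.

Lemma gmulA : associative gmul.
Proof.
move=> a b c; apply/ffunP => S; rewrite !ffunE.
under eq_bigr => A AS do rewrite ffunE big_distrr /=.
under [RHS]eq_bigr => D DS do rewrite ffunE mulrAC big_distrr /=.
rewrite [RHS](exchange_big_dep (mem (powerset S))) /=; last first.
  by move=> D A; rewrite !powersetE => DS AD; exact: (subset_trans AD DS).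
apply: eq_bigr => A; rewrite powersetE => AS.
rewrite [RHS](reindex_onto (fun B => A :|: B) (fun D => D :\: A)) /=; last first.
  move=> D; rewrite !powersetE => /andP[_ /subsetP AD].
  apply/setP => x; rewrite !inE; case xA: (x \in A) => //=.
  by rewrite (AD x xA).
apply: eq_big => B.
  rewrite !powersetE subUset AS subsetUl andbT /=.
  rewrite subsetD setDUl setDv set0U.
  by congr (_ && _); apply/setDidPl/eqP.
rewrite powersetE subsetD => /andP[BS dBA].
have -> : (A :|: B) :\: A = B by rewrite setDUl setDv set0U; apply/setDidPl.
rewrite -setDDl; set C := (S :\: A) :\: B.
have dBC : [disjoint B & C].
  by rewrite -setI_eq0; apply/eqP/setP => x; rewrite !inE; case: (x \in B).
have -> : S :\: A = B :|: C.
  apply/setP => x; rewrite !inE; case xB: (x \in B) => //=.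
  by rewrite (subsetP BS) // andbT (disjointFr dBA xB).
rewrite gsignUr // gsignUl 1?disjoint_sym //; ring.
Qed.

Lemma gmul1l : left_id gone gmul.
Proof.
move=> a; apply/ffunP => S; rewrite ffunE (bigD1 set0) ?powersetE ?sub0set //=.
rewrite big1 ?addr0 => [|A /andP[_ /negPf A0]].
  by rewrite setD0 gsign0l ffunE eqxx !mul1r.
by rewrite ffunE A0 mulr0 mul0r.
Qed.

Lemma gmul1r : right_id gone gmul.
Proof.
move=> a; apply/ffunP => S; rewrite ffunE (bigD1 S) ?powersetE //=.
rewrite big1 ?addr0 => [|A /andP[]]; rewrite ffunE.
  by rewrite setDv gsign0r eqxx mul1r mulr1.
rewrite powersetE setD_eq0 => AS /negPf AnS.
by rewrite (_ : S \subset A = false) ?mulr0 //; apply: contraFF AnS => SA;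
  rewrite eqEsubset AS.
Qed.

Lemma gmulDl : left_distributive gmul +%R.
Proof.
move=> a b c; apply/ffunP => S; rewrite !ffunE -big_split /=.
by apply: eq_bigr => A _; rewrite ffunE mulrDr mulrDl.
Qed.

Lemma gmulDr : right_distributive gmul +%R.
Proof.
move=> a b c; apply/ffunP => S; rewrite !ffunE -big_split /=.
by apply: eq_bigr => A _; rewrite ffunE mulrDr.
Qed.

Lemma gone_neq0 : gone != 0.
Proof. by apply/eqP => /ffunP/(_ set0)/eqP; rewrite !ffunE eqxx oner_eq0. Qed.

HB.instance Definition _ := GRing.Zmodule_isNzRing.Build grassmann
  gmulA gmul1l gmul1r gmulDl gmulDr gone_neq0.

Lemma gscaleAl (k : R) a b : k *: (a * b) = (k *: a) * b.
Proof.
apply/ffunP => S; rewrite !ffunE scaler_sumr; apply: eq_bigr => A _.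
by rewrite ffunE /GRing.scale /=; ring.
Qed.

HB.instance Definition _ := GRing.Lmodule_isLalgebra.Build R grassmann gscaleAl.

Lemma gscaleAr (k : R) a b : k *: (a * b) = a * (k *: b).
Proof.
apply/ffunP => S; rewrite !ffunE scaler_sumr; apply: eq_bigr => A _.
by rewrite ffunE /GRing.scale /=; ring.
Qed.

HB.instance Definition _ := GRing.Lalgebra_isAlgebra.Build R grassmann gscaleAr.

Definition gen (g : G) : grassmann := [ffun S : {set G} => (S == [set g])%:R].

(** Left derivative: [gder g (gen g * b) = b] when [g] does not occur in [b]. *)
Definition gder (g : G) a : grassmann :=
  [ffun S : {set G} => if g \in S then 0 else gsign [set g] S * a (g |: S)].

Definition gbody a : R := a set0.
Definition gsoul a : grassmann := a - (gbody a)%:A.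

(** Substitutes [0] for the generators in [S0]. *)
Definition gkill (S0 : {set G}) a : grassmann :=
  [ffun S : {set G} => if [disjoint S & S0] then a S else 0].

End Grassmann.

(* Imported only here: the notations of classical_sets shadow those of finset. *)
From mathcomp Require Import all_classical all_reals all_analysis.
Import numFieldNormedType.Exports.
Local Open Scope classical_set_scope.
Local Open Scope ring_scope.

(** The library registers [m1 \x m2] as [sigma_finite_measure] only for
  subprobabilities, hence this copy. *)
Section ProductMeasure.
Context d1 d2 (T1 : measurableType d1) (T2 : measurableType d2) (R : realType).
Variables (m1 : {sigma_finite_measure set T1 -> \bar R})
          (m2 : {sigma_finite_measure set T2 -> \bar R}).

Definition sprod : set (T1 * T2) -> \bar R := (m1 \x m2)%E.
HB.instance Definition _ := Measure.on sprod.

Let sprod_sigma_finite : sigma_finite setT sprod.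
Proof.
have /sigma_finiteP[F [TF ndF Foo]] := sigma_finiteT m1.
have /sigma_finiteP[G [TG ndG Goo]] := sigma_finiteT m2.
exists (fun n => F n `*` G n).
  rewrite -setXTT TF TG predeqE => -[x y]; split.
    move=> [/= [n _ Fnx] [k _ Gky]]; exists (maxn n k) => //; split.
    - by move: x Fnx; exact/subsetPset/ndF/leq_maxl.
    - by move: y Gky; exact/subsetPset/ndG/leq_maxr.
  by move=> [n _ []/= ? ?]; split; exists n.
move=> k; have [? ?] := Foo k; have [? ?] := Goo k.
split; first exact: measurableX.
by rewrite /sprod product_measure1E// lte_mul_pinfty// ge0_fin_numE.
Qed.

HB.instance Definition _ :=
  Measure_isSigmaFinite.Build _ _ _ sprod sprod_sigma_finite.

End ProductMeasure.

(** [n]-dimensional Lebesgue measure on [n.-tuple R]. *)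
Section LebesgueTuple.
Variable R : realType.
Local Notation mR := (measurableTypeR R).

Section step.
Variables (n : nat) (m : {sigma_finite_measure set (n.-tuple mR) -> \bar R}).

Definition cons_pair (p : mR * n.-tuple mR) : n.+1.-tuple mR :=
  [tuple of p.1 :: p.2].

Lemma measurable_cons_pair : measurable_fun [set: mR * n.-tuple mR] cons_pair.
Proof. exact: measurable_cons measurable_fst measurable_snd. Qed.

Definition lebesgue_cons : set (n.+1.-tuple mR) -> \bar R :=
  pushforward (sprod (@lebesgue_measure R) m) cons_pair.

Let mcons (A : set (n.+1.-tuple mR)) :
  measurable A -> measurable (cons_pair @^-1` A).
Proof. by move=> mA; rewrite -[X in measurable X]setTI; exact: measurable_cons_pair. Qed.

Let lebesgue_cons0 : lebesgue_cons set0 = 0%E.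
Proof. by rewrite /lebesgue_cons /pushforward preimage_set0 measure0. Qed.

Let lebesgue_cons_ge0 A : (0 <= lebesgue_cons A)%E.
Proof. by rewrite /lebesgue_cons /pushforward measure_ge0. Qed.

Let lebesgue_cons_sigma_additive : semi_sigma_additive lebesgue_cons.
Proof.
move=> F mF tF mUF; rewrite /lebesgue_cons /pushforward preimage_bigcup.
apply: measure_semi_sigma_additive.
- by move=> k; exact: mcons.
- apply/trivIsetP => /= i j _ _ ij; rewrite -preimage_setI.
  by move/trivIsetP : tF => /(_ _ _ _ _ ij) ->//; rewrite preimage_set0.
- by rewrite -preimage_bigcup; exact: mcons.
Qed.

HB.instance Definition _ := isMeasure.Build _ _ _ lebesgue_cons
  lebesgue_cons0 lebesgue_cons_ge0 lebesgue_cons_sigma_additive.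

Let lebesgue_cons_sigma_finite : sigma_finite setT lebesgue_cons.
Proof.
have [F FT Foo] := sigma_finiteT
  (sprod (@lebesgue_measure R) m).
pose un (t : n.+1.-tuple mR) : mR * n.-tuple mR := (thead t, [tuple of behead t]).
have mun : measurable_fun setT un.
  by apply/measurable_fun_pair; [exact: measurable_tnth|exact: measurable_behead].
have cK : cancel cons_pair un.
  by case=> x t; rewrite /un theadE; congr pair; exact: val_inj.
exists (fun k => un @^-1` F k).
  by rewrite -preimage_bigcup -FT preimage_setT.
move=> k; have [mFk Fk] := Foo k; split.
  by rewrite -[X in measurable X]setTI; exact: mun.
rewrite /lebesgue_cons /pushforward -comp_preimage.
by rewrite (_ : un \o cons_pair = id) //; apply/funext => p; exact: cK.
Qed.

HB.instance Definition _ := Measure_isSigmaFinite.Build _ _ _ lebesgue_cons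
  lebesgue_cons_sigma_finite.

End step.

Fixpoint lebesgue_tuple (n : nat) :
    {sigma_finite_measure set (n.-tuple mR) -> \bar R} :=
  match n with
  | 0 => dirac ([tuple] : 0.-tuple mR)
  | n'.+1 => lebesgue_cons (lebesgue_tuple n')
  end.

End LebesgueTuple.

Section Graph.
Variables (R : realType) (I : finType).

(** One representative [(i, j)] for each unoriented edge [{i, j}]. *)
Definition edges (e : rel I) : {set I * I} :=
  [set p | e p.1 p.2 && (enum_rank p.1 < enum_rank p.2)%N]%SET.

Definition spanning_tree (e : rel I) (T : {set I * I}) : Prop :=
  let adj := [rel i j | ((i, j) \in T) || ((j, i) \in T)] in
  [/\ T \subset edges e,
      forall i j, connect adj i j &
      forall c : seq I, (2 < size c)%N -> ~ ucycle adj c].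

Definition tree_sum (e : rel I) (W : I -> I -> R) (u : I -> R) : R :=
  \sum_(T : {set I * I} | `[< spanning_tree e T >])
    \prod_(p in T) (W p.1 p.2 * expR (u p.1 + u p.2)).

(** Density of [nu_{i0}^{W,z}] with respect to [\prod_(i != i0) du_i]; the
  factor [1_{u_{i0} = 0}] is accounted for by [extend]. The algebra [A] in which
  [z] takes its values is either [R] or a Grassmann algebra, [expA] being its
  exponential. *)
Definition nu_density (A : lalgType R) (expA : A -> A) (e : rel I)
    (W : I -> I -> R) (z : I -> A) (i0 : I) (u : I -> R) : A :=
  Num.sqrt (tree_sum e W u) *:
  (expA (- 2^-1 *: \sum_(p in edges e) W p.1 p.2 *:
      (expR (u p.1 - u p.2) *: z p.2 ^+ 2 + expR (u p.2 - u p.1) *: z p.1 ^+ 2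
       - 2 *: (z p.1 * z p.2)))
   * \prod_(i | i != i0) ((expR (- u i) / Num.sqrt (2 * pi)) *: z i)).

Definition nu1_density (e : rel I) (W : I -> I -> R) (i0 : I) (u : I -> R) : R :=
  @nu_density R^o expR e W (fun=> 1) i0 u.

Definition schroedinger (W : I -> I -> R) (u : I -> R) (i j : I) : R :=
  if i == j then \sum_(k | k != i) W i k * expR (u k - u i) else - W i j.

End Graph.

(** The graph with a cemetery point [None] added, [h i] being the weight of the
  edge between [None] and [Some i]. *)
Section Cemetery.
Variables (R : realType) (V : finType).

Definition ext_adj (e : rel V) (h : V -> R) : rel (option V) :=
  fun i j => match i, j with
  | Some i, Some j => e i j
  | Some i, None | None, Some i => 0 < h i
  | None, None => false
  end.

Definition ext_weight (W : V -> V -> R) (h : V -> R) (i j : option V) : R :=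
  match i, j with
  | Some i, Some j => W i j
  | Some i, None | None, Some i => h i
  | None, None => 0
  end.

End Cemetery.

Section Superfunctions.
Variables (R : realType) (I : finType).

(** Generators [inl i] and [inr i] are [xi_i] and [eta_i]. *)
Local Notation Lam := (grassmann R (I + I)%type).

(** A superfunction of the field, [F x y] being its value (a polynomial in the
  Grassmann variables) at the real variables [x, y]. *)
Definition superfun := (I -> R) -> (I -> R) -> Lam.

Fixpoint iter_derive (U : normedModType R) (vs : seq U) (f : U -> R) : U -> R :=
  if vs is v :: vs' then 'D_v (iter_derive vs' f) else f.

Definition smooth (U : normedModType R) (f : U -> R) : Prop :=
  forall vs : seq U, continuous (iter_derive vs f) /\
    forall x v, derivable (iter_derive vs f) x v.

Definition coord (v : 'rV[R]_#|I|) (i : I) : R := v 0 (enum_rank i).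

Definition smooth_superfun (F : superfun) : Prop := forall S : {set I + I},
  smooth (fun v : 'rV[R]_#|I| * 'rV[R]_#|I| => F (coord v.1) (coord v.2) S).

(** [f a] for an even [a]: the Taylor expansion of [f] at the body of [a], which
  terminates since [gsoul a ^+ k = 0] for [k > #|G|]. *)
Definition taylor (G : finType) (f : R -> R) (a : grassmann R G) :
    grassmann R G :=
  \sum_(k < #|G|.+1) (derive1n k f (gbody a) / (k`!)%:R) *: gsoul a ^+ k.

Definition gexp (a : Lam) : Lam := taylor expR a.
Definition ginv (a : Lam) : Lam := taylor (fun t => t^-1) a.

Definition xi (i : I) : Lam := gen R (inl i).
Definition eta (i : I) : Lam := gen R (inr i).

Definition zfield (x y : I -> R) (i : I) : Lam :=
  taylor Num.sqrt ((1 + x i ^+ 2 + y i ^+ 2)%:A + 2 *: (xi i * eta i)).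

Definition hyp_dot (x y : I -> R) (i j : I) : Lam :=
  (x i * x j + y i * y j)%:A - zfield x y i * zfield x y j
  + xi i * eta j + xi j * eta i.

Definition free_dot (x y : I -> R) (i j : I) : Lam :=
  (x i * x j + y i * y j)%:A + xi i * eta j + xi j * eta i.

(** ** Fixing the variables at one vertex *)

Variable p : I.

Definition dim : nat := #|predC1 p|.
Local Notation config := (dim.-tuple (measurableTypeR R)).
Local Notation leb := (lebesgue_tuple R dim).

(** The point of [I -> R] whose [p]-th coordinate is [c] and whose other
  coordinates are listed in [t]. *)
Definition extend (c : R) (t : config) : I -> R :=
  fun i => if i == p then c else nth 0 t (index i (enum (predC1 p))).

Definition sinh (s : R) : R := (expR s - expR (- s)) / 2.

(** Replaces the variables at [p] by [x_p = sinh s], [y_p = 0],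
  [xi_p = eta_p = 0]; then [zfield x y p] becomes [cosh s]. *)
Definition pin (s : R) (F : superfun) (t : config * config) : Lam :=
  gkill [set inl p; inr p]%SET (F (extend (sinh s) t.1) (extend 0 t.2)).

(** [\prod_(i != p) d xi_i d eta_i], where [d xi_i d eta_i] acts as the
  derivative with respect to [eta_i] followed by that with respect to [xi_i].
  Applied to elements not involving [xi_p, eta_p], it yields scalars. *)
Definition berezin (a : Lam) : R :=
  gbody (foldr (fun i b => gder (inl i) (gder (inr i) b)) a (enum (predC1 p))).

Definition leb2 := sprod leb leb.

Definition hyp_integrand (e : rel I) (W : I -> I -> R) (s : R) (F : superfun) :
    config * config -> R :=
  fun t => berezin (pin s (fun x y => F x y
    * gexp (\sum_(q in edges e) W q.1 q.2 *: (hyp_dot x y q.1 q.2 + 1))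
    * \prod_(i | i != p) ((2 * pi)^-1 *: ginv (zfield x y i))) t).

Definition hyp_bracket (e : rel I) (W : I -> I -> R) (s : R) (F : superfun) : R :=
  \int[leb2]_t hyp_integrand e W s F t.

Definition free_integrand (A : I -> I -> R) (s : R) (F : superfun) :
    config * config -> R :=
  fun t => berezin (pin s (fun x y =>
    (\prod_(i | i != p) (2 * pi)^-1) *:
    (F x y * gexp (- 2^-1 *: \sum_i \sum_j A i j *: free_dot x y i j))) t).

Definition free_bracket (A : I -> I -> R) (s : R) (F : superfun) : R :=
  \int[leb2]_t free_integrand A s F t.

End Superfunctions.

Arguments dim {I} p.
Arguments extend {R I} p c t.
Arguments leb2 {R I} p.
Arguments pin {R I} p s F t.
Arguments hyp_integrand {R I} p e W s F t.
Arguments free_integrand {R I} p A s F t.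

Section Mixing.
Variables (R : realType) (I : finType) (e : rel I) (W : I -> I -> R).
Variables (p i0 : I) (s : R).
Local Notation Lam := (grassmann R (I + I)%type).
Local Notation leb0 := (lebesgue_tuple R (dim i0)).

(** [g u] is a superfunction of the field, depending on [u : I -> R]. *)
Implicit Types (h : superfun R I) (g : (I -> R) -> superfun R I).

Definition nu_super g (u : I -> R) : superfun R I := fun x y =>
  g u x y * nu_density (@gexp R I) e W (zfield x y) i0 u.

(** [\int g nu_{i0}^{W,z}(du)], coefficientwise. *)
Definition mixed g : superfun R I := fun x y =>
  [ffun S : {set I + I} => \int[leb0]_t nu_super g (extend i0 0 t) x y S].

(** Absolute convergence of the integrals in [< h \int g nu_{i0}^{W,z}(du) >]. *)
Definition hyp_exists h g : Prop :=
  {ae leb2 p, forall t, forall S : {set I + I},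
    leb0.-integrable setT
      (fun r => (pin p s (nu_super g (extend i0 0 r)) t S)%:E)} /\
  (sprod (leb2 p) leb0).-integrable setT
    (fun q => (hyp_integrand p e W s
       (fun x y => h x y * nu_super g (extend i0 0 q.2) x y) q.1)%:E).

Definition free_mixed g : R :=
  \int[leb0]_r (let u := extend i0 0 r in
    free_bracket p (schroedinger W u) s (g u) * nu1_density e W i0 u).

(** Absolute convergence of the integrals in [free_mixed g]. *)
Definition free_exists g : Prop :=
  (sprod (leb2 p) leb0).-integrable setT
    (fun q => (let u := extend i0 0 q.2 in
      free_integrand p (schroedinger W u) s (g u) q.1 * nu1_density e W i0 u)%:E).

End Mixing.

(* Main.v *)
Require Import Defs.
From mathcomp Require Import all_boot all_order all_algebra.
From mathcomp Require Import ring.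
From mathcomp Require Import all_classical all_reals all_analysis.
From mathcomp Require Import measurable_realfun.
Set Implicit Arguments.
Unset Strict Implicit.
Unset Printing Implicit Defensive.
Import Order.TTheory GRing.Theory Num.Theory.
Local Open Scope ring_scope.

(** The two sides agree already before integration, as superfunctions of the
  field for each fixed [u] ([hyp_free_super]).

  Exponents. The hyperbolic action contributes
  [W_ij (Psi_i Psi_j - z_i z_j + 1)] for each edge, and the mixing density
  contributes [- W_ij / 2 (e^(u_i - u_j) z_j^2 + e^(u_j - u_i) z_i^2 - 2 z_i z_j)].
  The products [z_i z_j] cancel, and [z_i^2 = 1 + Psi_i Psi_i]. What is left is
  the quadratic form of the free field with matrix [A^u], plus a real constant
  which is the exponent of the mixing density at [z = 1] ([exponentE]).

  Prefactors. [D mu] carries [z_i^-1] for each [i] other than the pinned vertex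
  [p], and the mixing density carries [z_i] for each [i] other than [i0]. Their
  product with the ratio [z_i0 / z_p] is [1] ([nu_density_cancel]). For
  [i0 = p] that ratio is itself [1], so the second identity of the theorem is an
  instance of the same statement as the first one.

  In the Grassmann algebra this computation needs three facts: even elements are
  central ([even_gcentral]), the Taylor exponential is additive
  ([taylor_expRD]), and [z_i] is invertible with the expected square
  ([zfield_sqr], [zfieldV]).

  It remains to take the [u]-integral out of the Berezin and Lebesgue integrals.
  At a fixed field configuration the integrand is a linear combination of the
  finitely many Grassmann coefficients, so the Berezin integral commutes with
  the [u]-integral ([hyp_integrand_mixed]). Fubini's theorem then exchanges the
  two Lebesgue integrals ([mixing_identity]). *)

(** * Grassmann algebra: central elements and the degree filtration *)

Section GrassmannTheory.
Variables (R : comNzRingType) (G : finType).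
Local Notation Lam := (grassmann R G).
Implicit Types (a b c : Lam) (A B S : {set G}) (k : nat).

Lemma gcoefM a b S :
  (a * b) S = \sum_(A in powerset S) gsign R A (S :\: A) * a A * b (S :\: A)%SET.
Proof. by rewrite [LHS]ffunE. Qed.

(** Centrality replaces commutativity below: the [z_i] and the exponents are
  central, while the test superfunction [g] may be odd. *)
Definition gcentral a := forall b, a * b = b * a.

Lemma gcentral1 : gcentral 1.
Proof. by move=> b; rewrite mul1r mulr1. Qed.

Lemma gcentralD a b : gcentral a -> gcentral b -> gcentral (a + b).
Proof. by move=> ca cb c; rewrite mulrDl mulrDr ca cb. Qed.

Lemma gcentralZ (l : R) a : gcentral a -> gcentral (l *: a).
Proof. by move=> ca c; rewrite -scalerAl -scalerAr ca. Qed.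

Lemma gcentralM a b : gcentral a -> gcentral b -> gcentral (a * b).
Proof. by move=> ca cb c; rewrite -mulrA cb mulrA ca mulrA. Qed.

Lemma gcentralX a k : gcentral a -> gcentral (a ^+ k).
Proof.
by move=> ca; elim: k => [|k IH]; [exact: gcentral1|rewrite exprS; exact: gcentralM].
Qed.

Lemma gcentral_sum (J : Type) (r : seq J) (P : pred J) (F : J -> Lam) :
  (forall i, gcentral (F i)) -> gcentral (\sum_(i <- r | P i) F i).
Proof.
move=> cF; elim/big_rec: _ => [b|i a _]; first by rewrite mul0r mulr0.
exact: gcentralD.
Qed.

Lemma gcentral_prod (J : Type) (r : seq J) (P : pred J) (F : J -> Lam) :
  (forall i, gcentral (F i)) -> gcentral (\prod_(i <- r | P i) F i).
Proof.
move=> cF; elim/big_rec: _ => [|i a _]; first exact: gcentral1.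
exact: gcentralM.
Qed.

Lemma setDD_id A S : A \subset S -> (S :\: (S :\: A))%SET = A.
Proof.
by move=> /finset.setIidPr AS; rewrite finset.setDDr finset.setDv finset.set0U.
Qed.

(** Each pair [(g, h)] with [g] in [A] and [h] in [B] is inverted in exactly one
  of the two orders. *)
Lemma inversionsC A B : [disjoint A & B] ->
  (inversions A B + inversions B A = #|A| * #|B|)%N.
Proof.
move=> dAB; rewrite /inversions [X in (_ + X)%N]exchange_big -big_split /=.
rewrite -sum_nat_const; apply: eq_bigr => g gA; rewrite -big_split /=.
rewrite -[RHS]sum1_card; apply: eq_bigr => h hB.
have : enum_rank g != enum_rank h.
  by apply: contraTneq hB => /enum_rank_inj <-; rewrite (disjointFr dAB gA).
by rewrite -val_eqE /=; case: ltngtP.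
Qed.

Lemma gsignC A B : [disjoint A & B] -> ~~ odd #|A| -> gsign R A B = gsign R B A.
Proof.
move=> /inversionsC eAB eA; rewrite /gsign -signr_odd -[RHS]signr_odd.
have := congr1 odd eAB; rewrite oddD oddM (negPf eA) /=.
by do 2!case: (odd _).
Qed.

(** Moving a monomial of even degree past any other monomial costs an even
  number of transpositions. *)
Lemma even_gcentral a : (forall S, odd #|S| -> a S = 0) -> gcentral a.
Proof.
move=> ea b; apply/ffunP => S; rewrite !gcoefM.
rewrite [RHS](reindex_onto (fun A => S :\: A)%SET (fun A => S :\: A)%SET) /=; last first.
  by move=> A; rewrite powersetE => /setDD_id.
apply: eq_big => A; rewrite !powersetE.
  rewrite subsetDl /=; apply/idP/eqP => [/setDD_id //|<-]; exact: subsetDl.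
move=> /setDD_id ->.
have [oA|eA] := boolP (odd #|A|); first by rewrite ea // !mulr0 mul0r.
have dA : [disjoint A & (S :\: A)%SET].
  by rewrite -setI_eq0 finset.setIDA finset.setIC -finset.setIDA finset.setDv finset.setI0.
by rewrite gsignC // -!mulrA [b _ * _]mulrC.
Qed.

Lemma gen_sqr (g : G) : gen R g * gen R g = 0.
Proof.
apply/ffunP => S; rewrite gcoefM ffunE big1 // => A _; rewrite !ffunE.
have [->|] := eqVneq A [set g]%SET; last by rewrite mulr0 mul0r.
case: eqP => [/setP/(_ g)|_]; last by rewrite mulr0.
by rewrite !inE eqxx.
Qed.

Lemma gen_mul_central (g h : G) : gcentral (gen R g * gen R h).
Proof.
apply: even_gcentral => S oS; rewrite gcoefM big1 // => A; rewrite powersetE => AS.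
rewrite !ffunE; case: (eqVneq A [set g]%SET) => [Ag|_]; last by rewrite mulr0 mul0r.
case: eqP => [Sh|_]; last by rewrite mulr0.
have := cardsID A S; rewrite Sh (finset.setIidPr AS) Ag !cards1 => cS.
by rewrite -cS in oS.
Qed.

Lemma gbodyM a b : gbody (a * b) = gbody a * gbody b.
Proof. by rewrite /gbody gcoefM powerset0 big_set1 finset.setD0 gsign0l mul1r. Qed.

Lemma gbodyD a b : gbody (a + b) = gbody a + gbody b.
Proof. by rewrite /gbody ffunE. Qed.

Lemma gbodyZ (l : R) a : gbody (l *: a) = l * gbody a.
Proof. by rewrite /gbody ffunE. Qed.

Lemma gbodyA (l : R) : gbody (l%:A : Lam) = l.
Proof. by rewrite gbodyZ /gbody ffunE eqxx mulr1. Qed.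

Lemma gbody_gen (g : G) : gbody (gen R g) = 0.
Proof.
rewrite /gbody ffunE; case: eqP => // /setP/(_ g).
by rewrite !inE eqxx.
Qed.

Lemma gsoulD a b : gsoul (a + b) = gsoul a + gsoul b.
Proof. by rewrite /gsoul gbodyD scalerDl opprD addrACA. Qed.

Lemma gsoul_central a : gcentral a -> gcentral (gsoul a).
Proof.
move=> ca; rewrite /gsoul -scaleN1r; apply: gcentralD ca _.
by apply/gcentralZ/gcentralZ/gcentral1.
Qed.

(** The degree filtration of the Grassmann algebra. *)
Definition vanish_below k a := forall S, (#|S| < k)%N -> a S = 0.

Lemma vanish_belowM k l a b :
  vanish_below k a -> vanish_below l b -> vanish_below (k + l) (a * b).
Proof.
move=> oa ob S Skl; rewrite gcoefM big1 // => A; rewrite powersetE => AS.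
have [Ak|kA] := ltnP #|A| k; first by rewrite oa // mulr0 mul0r.
rewrite ob ?mulr0 // -(ltn_add2l #|A|).
have -> : (#|A| + #|S :\: A|%SET = #|S|)%N by rewrite -(cardsID A S) (finset.setIidPr AS).
by apply: leq_trans Skl _; rewrite leq_add2r.
Qed.

Lemma vanish_belowX a k : vanish_below 1 a -> vanish_below k (a ^+ k).
Proof.
move=> oa; elim: k => [S//|k IH]; rewrite exprS -add1n; exact: vanish_belowM.
Qed.

Lemma vanish_below_soul a : vanish_below 1 (gsoul a).
Proof.
move=> S; rewrite ltnS leqn0 cards_eq0 => /eqP ->.
by rewrite /gsoul !ffunE -/(gbody a) eqxx /GRing.scale /= mulr1 subrr.
Qed.

Lemma vanish_below_eq0 k a : (#|G| < k)%N -> vanish_below k a -> a = 0.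
Proof.
move=> Gk oa; apply/ffunP => S; rewrite ffunE oa //.
by apply: leq_ltn_trans Gk; exact: max_card.
Qed.

(** The degree of a monomial is at most the number of generators, and souls have
  no monomial of degree [0]. *)
Lemma gsoul_nilpotent a b k l : (#|G| < k + l)%N -> gsoul a ^+ k * gsoul b ^+ l = 0.
Proof.
move=> Gkl; apply: vanish_below_eq0 Gkl _.
by apply: vanish_belowM; apply: vanish_belowX; exact: vanish_below_soul.
Qed.

Lemma gkillM (S0 : {set G}) a b : gkill S0 (a * b) = gkill S0 a * gkill S0 b.
Proof.
apply/ffunP => S; rewrite ffunE !gcoefM; case: ifPn => [dS|ndS].
  apply: eq_bigr => A; rewrite powersetE => AS; rewrite !ffunE.
  by rewrite (disjointWl AS) // (disjointWl _ dS) // subsetDl.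
rewrite big1 // => A; rewrite powersetE => AS; rewrite !ffunE.
case: ifPn => dA; last by rewrite mulr0 mul0r.
case: ifPn => dB; last by rewrite mulr0.
case/negP: ndS; rewrite -(setID S A) (finset.setIidPr AS).
by rewrite -setI_eq0 finset.setIUl finset.setU_eq0 !setI_eq0 dA dB.
Qed.

Lemma gkillZ (S0 : {set G}) (l : R) a : gkill S0 (l *: a) = l *: gkill S0 a.
Proof. by apply/ffunP => S; rewrite !ffunE; case: ifP; rewrite ?scaler0. Qed.

Lemma gderD (g : G) a b : gder g (a + b) = gder g a + gder g b.
Proof. by apply/ffunP => S; rewrite !ffunE; case: ifP; rewrite ?addr0 ?mulrDr. Qed.

Lemma gderZ (g : G) (l : R) a : gder g (l *: a) = l *: gder g a.
Proof.
apply/ffunP => S; rewrite !ffunE; case: ifP; rewrite ?scaler0 // => _.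
by rewrite /GRing.scale /= mulrCA.
Qed.

Lemma prod_gcentralM (J : Type) (r : seq J) (F H : J -> Lam) :
  (forall i, gcentral (H i)) ->
  (\prod_(i <- r) F i) * (\prod_(i <- r) H i) = \prod_(i <- r) (F i * H i).
Proof.
move=> cH; elim: r => [|i r IH]; first by rewrite !big_nil mulr1.
by rewrite !big_cons -IH -!mulrA; congr (_ * _); rewrite !mulrA cH.
Qed.

(** The analogue of [bigD1], which is stated for commutative operators. *)
Lemma prod_gcentralD1 (J : finType) (j : J) (F : J -> Lam) :
  (forall i, gcentral (F i)) -> F j * \prod_(i | i != j) F i = \prod_i F i.
Proof.
move=> cF; pose E i : Lam := if i == j then F j else 1.
transitivity (\prod_i E i * \prod_i (if i != j then F i else 1)).
  congr (_ * _); last by rewrite big_mkcond.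
  have := mem_index_enum j; have := index_enum_uniq J.
  elim: (index_enum J) => // i r IH /= /andP[ir ur]; rewrite big_cons inE /E.
  have [-> _|_ /= jr] := eqVneq j i.
    rewrite big1_seq ?mulr1 // => l /andP[_ lr].
    by case: eqP => // li; rewrite -li lr in ir.
  by rewrite mul1r; exact: IH.
rewrite prod_gcentralM; last by move=> i; case: ifP => _; [exact: cF|exact: gcentral1].
by apply: eq_bigr => i _; rewrite /E; case: eqP => [->|_] /=; rewrite ?mulr1 ?mul1r.
Qed.

(** The rearrangement behind the cancellation of the [z_i]: [z * z'] is the ratio
  [z_i0 / z_p], [f] is [g], [Y] and [cu *: Z] are the exponential and the product
  in the mixing density, [X] is the exponential of the hyperbolic action, and
  [cp *: Z'] is the density of [D mu]. *)
Lemma gcentral_regroup (k cu cp : R) (z z' Z Z' X Y f : Lam) :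
  gcentral z -> gcentral z' -> gcentral Z -> gcentral Y ->
  z * z' * (f * (k *: (Y * (cu *: Z)))) * X * (cp *: Z')
  = (k * cu * cp) *: (f * (X * Y) * ((z * Z) * (z' * Z'))).
Proof.
move=> cz cz' cZ cY.
have sw c a b : gcentral c -> a * (c * b) = c * (a * b).
  by move=> cc; rewrite mulrA -cc -mulrA.
rewrite -!(scalerAl, scalerAr) !scalerA [cp * _]mulrC -!mulrA; congr (_ *: _).
rewrite (sw Y X) // (sw z X) // (sw z Y) // (sw z f) //.
by rewrite (sw z' Z) // (sw z' X) // (sw z' Y) // (sw z' f) // (sw Z X).
Qed.

(** The functions [[ffun T => (T == S)%:R]] are the monomials [e_S]. *)
Lemma linear_gcoef (L : Lam -> R) :
  (forall (l : R) a b, L (l *: a + b) = l * L a + L b) ->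
  forall a, L a = \sum_S a S * L [ffun T : {set G} => (T == S)%:R].
Proof.
move=> LP a.
have LD : {morph L : b c / b + c >-> b + c} by move=> b c; rewrite -{1}[b]scale1r LP mul1r.
have L0 : L 0 = 0 by apply: (addIr (L 0)); rewrite -LD !add0r.
have LZ l b : L (l *: b) = l * L b by rewrite -[X in L X]addr0 LP L0 addr0.
have {1}-> : a = \sum_S a S *: ([ffun T : {set G} => (T == S)%:R] : Lam).
  apply/ffunP => T; rewrite sum_ffunE (bigD1 T) //= !ffunE eqxx.
  rewrite big1 => [|S /negPf ST]; first by rewrite addr0 /GRing.scale /= mulr1.
  by rewrite !ffunE eq_sym ST /GRing.scale /= mulr0.
by rewrite (big_morph L LD L0); apply: eq_bigr => S _; rewrite LZ.
Qed.

End GrassmannTheory.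

(** * Taylor expansion of functions of even elements *)

Section Taylor.
Variables (R : realType) (G : finType).
Local Notation Lam := (grassmann R G).
Implicit Types (a b : Lam).

Lemma taylor_gcentral (f : R -> R) a : gcentral a -> gcentral (taylor f a).
Proof.
move=> ca; apply: gcentral_sum => k; apply/gcentralZ/gcentralX.
exact: gsoul_central.
Qed.

(** Only two terms of the Taylor expansion survive. The hypothesis on [#|G|]
  ensures that the truncated expansion reaches order one. *)
Lemma taylor_sqr0 (f : R -> R) (l : R) (n : Lam) : (0 < #|G|)%N ->
  gbody n = 0 -> n * n = 0 ->
  taylor f (l%:A + n) = (f l)%:A + (derive1 f l) *: n.
Proof.
move=> G0 n0 nn; have bE : gbody (l%:A + n) = l by rewrite gbodyD gbodyA n0 addr0.
have sE : gsoul (l%:A + n) = n by rewrite /gsoul bE addrAC subrr add0r.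
rewrite /taylor bE sE; case: #|G| G0 => // m _.
rewrite 2!big_ord_recl big1 => [|k _] /=; last by rewrite !exprS mulrA nn mul0r scaler0.
by rewrite addr0 !divr1.
Qed.

(** Summation by antidiagonals [m = i + j]. *)
Lemma sum_triangle (M : nmodType) (n : nat) (F : nat -> nat -> M) :
  (forall i j, (n <= i + j)%N -> F i j = 0) ->
  \sum_(i < n) \sum_(j < n) F i j = \sum_(m < n) \sum_(i < m.+1) F i (m - i)%N.
Proof.
move=> F0.
transitivity (\sum_(i < n) \sum_(m < n | (i <= m)%N) F i (m - i)%N).
  apply: eq_bigr => i _; rewrite -(big_mkord xpredT (F i)).
  have hi : \sum_(n - i <= j < n) F i j = 0.
    by rewrite big_nat big1 // => j /andP[nj _]; apply: F0; rewrite -leq_subLR.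
  rewrite (big_cat_nat (n := (n - i)%N)) ?leq_subr //= hi addr0.
  rewrite -(big_mkord (fun m => (i <= m)%N) (fun m => F i (m - i)%N)).
  have lo : \sum_(0 <= m < i | (i <= m)%N) F i (m - i)%N = 0.
    rewrite big_nat_cond big1 // => m /andP[/andP[_ mi] im].
    by rewrite leqNgt mi in im.
  rewrite (big_cat_nat (n := i) _ (ltnW (ltn_ord i))) //= lo add0r.
  (* Shift of the index: [m = j + i]. *)
  rewrite -[in RHS](add0n (nat_of_ord i)) big_addn; apply: congr_big_nat => // j.
    by move=> _; rewrite leq_addl.
  by rewrite addnK.
rewrite (exchange_big_dep xpredT) //=; apply: eq_bigr => m _.
by rewrite (big_ord_widen n (fun i => F i (m - i)%N)).
Qed.

Lemma derive1n_expR k : derive1n k expR = expR :> (R -> R).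
Proof.
elim: k => [//|k IH]; rewrite derive1nS IH.
by apply/funext => x; rewrite derive1E (@derive_val _ _ _ _ _ _ _ (is_derive_expR x)).
Qed.

Lemma taylor_expRE a :
  taylor expR a = expR (gbody a) *: \sum_(k < #|G|.+1) (k`!%:R)^-1 *: gsoul a ^+ k.
Proof.
rewrite /taylor scaler_sumr; apply: eq_bigr => k _.
by rewrite derive1n_expR scalerA.
Qed.

(** The Cauchy product of two truncated exponential series. The truncation is
  exact since the terms of total order larger than [#|G|] vanish. *)
Lemma taylor_expRD a b : gcentral b ->
  taylor expR (a + b) = taylor expR a * taylor expR b.
Proof.
move=> cb; rewrite !taylor_expRE gbodyD expRD gsoulD.
rewrite -scalerAl -scalerAr scalerA; congr (_ *: _).
(* This discharges the side condition of the binomial formula below. *)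
have comm_soul : GRing.comm (gsoul b) (gsoul a) by exact: gsoul_central.
rewrite mulr_suml.
under [RHS]eq_bigr do rewrite mulr_sumr.
rewrite (@sum_triangle _ _ (fun i j => ((i`!%:R)^-1 *: gsoul a ^+ i) *
   ((j`!%:R)^-1 *: gsoul b ^+ j))); last first.
  by move=> i j ij; rewrite -scalerAl -scalerAr gsoul_nilpotent // !scaler0.
apply: eq_bigr => m _; rewrite addrC exprDn_comm // scaler_sumr.
apply: eq_bigr => i _; rewrite -scalerAl -scalerAr -[_ *+ 'C(_, _)]scaler_nat !scalerA.
rewrite gcentralX; last exact: gsoul_central.
congr (_ *: _); have im : (i <= m)%N by rewrite -ltnS.
rewrite -(bin_fact im) !natrM; field.
by rewrite !pnatr_eq0 -!lt0n !fact_gt0 bin_gt0 im.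
Qed.

Lemma taylor_expR_shift (l : R) a : taylor expR (l%:A + a) = expR l *: taylor expR a.
Proof.
rewrite !taylor_expRE gbodyD gbodyA expRD scalerA; congr (_ *: _).
apply: eq_bigr => k _; rewrite gsoulD (_ : gsoul l%:A = 0) ?add0r //.
by rewrite /gsoul gbodyA subrr.
Qed.

End Taylor.

Section Field.
Variables (R : realType) (I : finType).
Local Notation Lam := (grassmann R (I + I)%type).
Implicit Types (x y : I -> R) (i j : I).

Local Notation n i := (xi R i * eta R i : Lam).
Local Notation r x y i := (Num.sqrt (1 + x i ^+ 2 + y i ^+ 2)).

Lemma card_gen_gt0 i : (0 < #|{: I + I}|)%N.
Proof. by apply/card_gt0P; exists (inl i). Qed.

Lemma xieta_central i j : gcentral (xi R i * eta R j).
Proof. exact: gen_mul_central. Qed.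

Lemma xieta_body i : gbody (n i) = 0.
Proof. by rewrite gbodyM gbody_gen mul0r. Qed.

Lemma xieta_sqr0 i : n i * n i = 0.
Proof.
by rewrite mulrA (xieta_central i i (xi R i)) mulrA gen_sqr !mul0r.
Qed.

Lemma zfield_rad_gt0 x y i : 0 < 1 + x i ^+ 2 + y i ^+ 2.
Proof. by rewrite -addrA ltr_wpDr // addr_ge0 // sqr_ge0. Qed.

Lemma zfieldE x y i : zfield x y i = (r x y i)%:A + (r x y i)^-1 *: n i.
Proof.
rewrite /zfield taylor_sqr0.
- have d := is_derive1_sqrt (zfield_rad_gt0 x y i).
  rewrite derive1E (@derive_val _ _ _ _ _ _ _ d) scalerA; congr (_ + _ *: _).
  by rewrite invfM mulrAC mulVf ?pnatr_eq0 // mul1r.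
- exact: card_gen_gt0.
- by rewrite gbodyZ xieta_body mulr0.
- by rewrite -scalerAl -scalerAr xieta_sqr0 !scaler0.
Qed.

Lemma zfield_central x y i : gcentral (zfield x y i).
Proof.
apply: taylor_gcentral; apply: gcentralD; first exact/gcentralZ/gcentral1.
exact/gcentralZ/xieta_central.
Qed.

Lemma ginv_zfield_central x y i : gcentral (ginv (zfield x y i)).
Proof. exact/taylor_gcentral/zfield_central. Qed.

(** With [z = r + n / r] and [n^2 = 0], one gets [z^2 = r^2 + 2 n]. *)
Lemma zfield_sqr x y i : zfield x y i ^+ 2 = 1 + free_dot x y i i.
Proof.
have r0 : r x y i != 0 by rewrite gt_eqF // sqrtr_gt0 zfield_rad_gt0.
rewrite zfieldE expr2 mulrDl !mulrDr -!scalerAl -!scalerAr !mul1r mulr1 xieta_sqr0.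
rewrite !scaler0 addr0 !scalerA mulfV // mulVf // scale1r -expr2.
rewrite sqr_sqrtr ?ltW ?zfield_rad_gt0 // /free_dot -!expr2 !scalerDl scale1r.
by rewrite !addrA.
Qed.

(** With [z = r + n / r] and [n^2 = 0], the inverse is [1 / r - n / r^3]. *)
Lemma zfieldV x y i : zfield x y i * ginv (zfield x y i) = 1.
Proof.
have r0 : r x y i != 0 by rewrite gt_eqF // sqrtr_gt0 zfield_rad_gt0.
rewrite zfieldE /ginv taylor_sqr0.
- have d := @is_deriveV _ id _ _ _ r0 (is_derive_id _ _).
  rewrite derive1E (@derive_val _ _ _ _ _ _ _ (d 1)).
  rewrite mulrDl !mulrDr -!scalerAl -!scalerAr !mul1r mulr1 xieta_sqr0.
  rewrite !scaler0 addr0 !scalerA mulfV // scale1r -addrA -scalerDl.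
  rewrite [X in _ + X *: _](_ : _ = 0) ?scale0r ?addr0 //.
  by rewrite /GRing.scale /=; field.
- exact: card_gen_gt0.
- by rewrite gbodyZ xieta_body mulr0.
- by rewrite -scalerAl -scalerAr xieta_sqr0 !scaler0.
Qed.

Lemma free_dotC x y i j : free_dot x y i j = free_dot x y j i.
Proof. by rewrite /free_dot addrAC [x i * _]mulrC [y i * _]mulrC. Qed.

Lemma hyp_dotE x y i j :
  hyp_dot x y i j = free_dot x y i j - zfield x y i * zfield x y j.
Proof. by rewrite /hyp_dot /free_dot [_ - _ + _]addrAC [RHS]addrAC. Qed.

End Field.

Section Exponents.
Variables (R : realType) (I : finType) (e : rel I) (W : I -> I -> R).
Hypotheses (e_sym : symmetric e) (W_sym : forall i j, W i j = W j i)
  (W_eq0 : forall i j, ~~ e i j -> W i j = 0).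
Local Notation Lam := (grassmann R (I + I)%type).

(** [edges] keeps one orientation of each edge, hence the two terms. *)
Lemma sum_edges (M : nmodType) (F : I -> I -> M) :
  (forall i j, ~~ e i j -> F i j = 0) ->
  \sum_i \sum_(j | j != i) F i j = \sum_(q in edges e) (F q.1 q.2 + F q.2 q.1).
Proof.
move=> F0; rewrite pair_big_dep /= big_split /=.
rewrite (bigID (fun q : I * I => e q.1 q.2)) /= [X in _ + X]big1 ?addr0; last first.
  by move=> q /andP[_]; exact: F0.
(* Split according to the orientation; the reversed pairs are swapped back. *)
rewrite (bigID (fun q : I * I => (enum_rank q.1 < enum_rank q.2)%N)) /=.
have neq (i j : I) : (enum_rank i < enum_rank j)%N -> (j != i) && (i != j).
  by rewrite [i == j]eq_sym andbb; apply: contraTneq => ->; rewrite ltnn.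
congr (_ + _).
  apply: eq_bigl => q; rewrite inE -andbA andbC -andbA.
  apply/and3P/andP => [[//]|[eq lq]]; by split => //; case/andP: (neq _ _ lq).
rewrite (reindex (@swap_pair I I)) /=; last by exists (@swap_pair I I); case.
apply: eq_bigl => -[i j] /=; rewrite inE /= e_sym -leqNgt -andbA andbCA.
congr (_ && _); apply/andP/idP => [[ij lij]|lij].
  rewrite ltn_neqAle lij andbT; apply: contraNneq ij.
  by move=> /val_inj/enum_rank_inj ->.
by split; [case/andP: (neq _ _ lij)|exact: ltnW].
Qed.

(** The contribution of one edge [{1, 2}], with [z] for [z_1 z_2] and [one + Dii]
  for [z_i^2]: the products [z] cancel. *)
Lemma exponent_edge (l E F : R) (one z D11 D22 D12 : Lam) :
  l *: (D12 - z + one)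
  + - 2^-1 *: (l *: (E *: (one + D22) + F *: (one + D11) - 2 *: z))
  = (- 2^-1 * (l * (E + F - 2))) *: one
    + - 2^-1 *: ((l * F) *: D11 - l *: D12 + ((l * E) *: D22 - l *: D12)).
Proof.
by apply/ffunP => S; rewrite !ffunE /GRing.scale /=; field.
Qed.

(** The terms [W_ij z_i z_j] cancel edge by edge, and the remaining squares
  [z_i^2 = 1 + Psi_i Psi_i] supply both the diagonal of [A^u] and the real
  constant. *)
Lemma exponentE (x y u : I -> R) :
  \sum_(q in edges e) W q.1 q.2 *: (hyp_dot x y q.1 q.2 + 1)
  + - 2^-1 *: (\sum_(q in edges e) W q.1 q.2 *:
      (expR (u q.1 - u q.2) *: zfield x y q.2 ^+ 2
       + expR (u q.2 - u q.1) *: zfield x y q.1 ^+ 2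
       - 2 *: (zfield x y q.1 * zfield x y q.2)))
  = (- 2^-1 * \sum_(q in edges e) W q.1 q.2 *
       (expR (u q.1 - u q.2) + expR (u q.2 - u q.1) - 2))%:A
    + (- 2^-1 *: \sum_i \sum_j schroedinger W u i j *: free_dot x y i j).
Proof.
(* The fields are made opaque: unification would otherwise unfold them when
   comparing their values at different vertices. *)
move: (zfield x y) (zfield_sqr x y) (hyp_dotE x y) (free_dotC x y).
move: (hyp_dot x y) (free_dot x y) => H D z zE HE DC.
(* The diagonal entry [A_ii] is itself a sum over [j], so that the quadratic form
   is a sum over pairs. *)
have AE : \sum_i \sum_j schroedinger W u i j *: D i j =
    \sum_i \sum_(j | j != i) ((W i j * expR (u j - u i)) *: D i i
       - W i j *: D i j).
  apply: eq_bigr => i _; rewrite (bigD1 i) //= /schroedinger eqxx scaler_suml.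
  rewrite -big_split /=; apply: eq_bigr => j ji.
  by rewrite eq_sym (negPf ji) scaleNr.
rewrite AE sum_edges; last by move=> i j /W_eq0 ->; rewrite mul0r !scale0r subrr.
rewrite !scaler_sumr mulr_sumr scaler_suml -!big_split /=.
apply: eq_bigr => q _.
rewrite HE !zE (DC q.2) (W_sym q.2).
exact: exponent_edge.
Qed.

End Exponents.

(** * Exchanging integrals *)

Section IntegralPart.
Local Open Scope classical_set_scope.

Section AeIntegral.
Context d (T : measurableType d) (R : realType) (mu : {measure set T -> \bar R}).
Import HBNNSimple.

(** This does not rest on measurability: the integral of a nonnegative function is
  the supremum of the integrals of the simple functions below it, and a simple
  function below [f], cut off outside the exceptional set, lies below [g] and has
  the same integral. *)
Lemma ae_ge0_le_integral_nonmeas (f g : T -> \bar R) :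
  (forall x, 0 <= f x)%E -> (forall x, 0 <= g x)%E ->
  {ae mu, forall x, f x = g x} -> (\int[mu]_x f x <= \int[mu]_x g x)%E.
Proof.
move=> f0 g0 [N [mN N0 fgN]].
rewrite [leLHS]ge0_integralTE // [leRHS]ge0_integralTE //.
apply: ge_ereal_sup => _ [k /= kf <-].
have mNC : measurable (~` N) by exact: measurableC.
apply: ereal_sup_ubound; exists (proj_nnsfun k mNC) => /=.
  move=> x; rewrite mindicE; have [xN|xN] := boolP (x \in ~` N).
    rewrite mulr1; have fgx : f x = g x.
      by apply: contrapT => fgx; move: xN; rewrite inE; apply; exact: fgN.
    by rewrite -fgx.
  by rewrite mulr0.
have intE (h : {nnsfun T >-> R}) : sintegral mu h = (\int[mu]_x (h x)%:E)%E.
  by rewrite integral_nnsfun // patch_setT.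
rewrite !intE; apply: ge0_ae_eq_integral => //.
- by apply/measurable_EFinP.
- by apply/measurable_EFinP.
- by move=> x _; rewrite lee_fin fun_ge0.
- by move=> x _; rewrite lee_fin fun_ge0.
exists N; split => // x /= /not_implyP[_] kx; apply: contrapT => xN.
by apply: kx; rewrite mindicE mem_set // mulr1.
Qed.

Lemma ae_eq_integral_nonmeas (f g : T -> \bar R) :
  {ae mu, forall x, f x = g x} -> (\int[mu]_x f x = \int[mu]_x g x)%E.
Proof.
move=> fg; have gf : {ae mu, forall x, g x = f x}.
  by apply: filterS fg => x ->.
rewrite integralE [RHS]integralE; congr (_ - _)%E; apply/eqP; rewrite eq_le.
  by apply/andP; split; apply: ae_ge0_le_integral_nonmeas => //;
    [move: fg|move: gf]; apply: filterS => x fgx; rewrite !funeposE fgx.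
by apply/andP; split; apply: ae_ge0_le_integral_nonmeas => //;
  [move: fg|move: gf]; apply: filterS => x fgx; rewrite !funenegE fgx.
Qed.

Lemma Rintegral_0 : \int[mu]_x 0 = 0 :> R.
Proof. by rewrite /Rintegral integral0_eq. Qed.

Lemma Rintegral_sum (J : Type) (r : seq J) (F : J -> T -> R) :
  (forall i, mu.-integrable setT (EFin \o F i)) ->
  \int[mu]_x (\sum_(i <- r) F i x) = \sum_(i <- r) \int[mu]_x F i x.
Proof.
move=> iF; elim: r => [|i r IH].
  by rewrite big_nil -[RHS]Rintegral_0; apply: eq_Rintegral => x _; rewrite big_nil.
rewrite big_cons -IH -RintegralD //; last first.
  rewrite (_ : _ \o _ = fun x => (\sum_(i <- r) (F i x)%:E)%E).
    exact: (integrable_sum measurableT r (fun i _ => iF i)).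
  by apply/funext => x /=; rewrite sumEFin.
by apply: eq_Rintegral => x _; rewrite big_cons.
Qed.

Lemma EFin_Rintegral (f : T -> R) : mu.-integrable setT (EFin \o f) ->
  (\int[mu]_x f x)%:E = (\int[mu]_x (f x)%:E)%E.
Proof. by move=> /integrable_fin_num fi; rewrite fineK // fi. Qed.

End AeIntegral.

Section FubiniReal.
Context d1 d2 (T1 : measurableType d1) (T2 : measurableType d2) (R : realType).
Variables (m1 : {sigma_finite_measure set T1 -> \bar R})
          (m2 : {sigma_finite_measure set T2 -> \bar R}).

(** Partial integrals are only prescribed almost everywhere, and [F] and [K] need
  not be measurable: after the Berezin integration, the mixed superfunction is
  only controlled at almost every field configuration. *)
Lemma Fubini_Rintegral (H : T1 * T2 -> R) (F : T1 -> R) (K : T2 -> R) :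
  (sprod m1 m2).-integrable setT (fun z => (H z)%:E) ->
  {ae m1, forall x, F x = \int[m2]_y H (x, y)} ->
  {ae m2, forall y, K y = \int[m1]_x H (x, y)} ->
  \int[m1]_x F x = \int[m2]_y K y.
Proof.
move=> iH FE KE; rewrite /Rintegral; congr fine.
rewrite (@ae_eq_integral_nonmeas _ _ _ m1 _ (fun x => \int[m2]_y (H (x, y))%:E)%E).
  rewrite (@ae_eq_integral_nonmeas _ _ _ m2 _ (fun y => \int[m1]_x (H (x, y))%:E)%E).
    by have /= := Fubini iH.
  by apply: filterS2 KE (ae_integrable2 iH) => y -> iy; rewrite EFin_Rintegral.
by apply: filterS2 FE (ae_integrable1 iH) => x -> ix; rewrite EFin_Rintegral.
Qed.

End FubiniReal.

End IntegralPart.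

(** * The change of measure *)

Section ChangeOfMeasure.
Variables (R : realType) (I : finType) (e : rel I) (W : I -> I -> R).
Hypotheses (e_sym : symmetric e) (W_sym : forall i j, W i j = W j i)
  (W_eq0 : forall i j, ~~ e i j -> W i j = 0).
Variables (p i0 : I) (s : R).
Local Notation Lam := (grassmann R (I + I)%type).

Local Notation ratio :=
  ((fun x y => zfield x y i0 * ginv (zfield x y p)) : superfun R I).

Lemma nu1_densityE (u : I -> R) : nu1_density e W i0 u =
  Num.sqrt (tree_sum e W u) *
  (expR (- 2^-1 * \sum_(q in edges e) W q.1 q.2 *
       (expR (u q.1 - u q.2) + expR (u q.2 - u q.1) - 2))
   * \prod_(i | i != i0) (expR (- u i) / Num.sqrt (2 * pi))).
Proof.
rewrite /nu1_density /nu_density /GRing.scale /=; congr (_ * (expR (_ * _) * _)).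
  by apply: eq_bigr => q _; rewrite expr1n !mulr1.
by apply: eq_bigr => i _; rewrite mulr1.
Qed.

(** The prefactors: [z_i0 / z_p] times the products of the [z_i] for [i != i0] and
  of the inverses [z'_i] for [i != p] is [1]; the two exponentials combine. *)
Lemma nu_density_cancel (z z' : I -> Lam) (u : I -> R) (X f : Lam) :
  (forall i, gcentral (z i)) -> (forall i, gcentral (z' i)) ->
  (forall i, z i * z' i = 1) ->
  z i0 * z' p * (f * nu_density (@gexp R I) e W z i0 u) * gexp X
  * \prod_(i | i != p) ((2 * pi)^-1 *: z' i)
  = (Num.sqrt (tree_sum e W u)
     * \prod_(i | i != i0) (expR (- u i) / Num.sqrt (2 * pi))
     * \prod_(i | i != p) (2 * pi)^-1) *:
    (f * gexp (X + - 2^-1 *: \sum_(q in edges e) W q.1 q.2 *: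
      (expR (u q.1 - u q.2) *: z q.2 ^+ 2 + expR (u q.2 - u q.1) *: z q.1 ^+ 2
       - 2 *: (z q.1 * z q.2)))).
Proof.
move=> cz cz' zV; rewrite /nu_density.
have cY : gcentral (- 2^-1 *: \sum_(q in edges e) W q.1 q.2 *:
    (expR (u q.1 - u q.2) *: z q.2 ^+ 2 + expR (u q.2 - u q.1) *: z q.1 ^+ 2
     - 2 *: (z q.1 * z q.2))).
  apply/gcentralZ/gcentral_sum => q; apply: gcentralZ.
  apply: gcentralD; first by apply: gcentralD; apply/gcentralZ/gcentralX.
  by rewrite -scaleN1r; apply/gcentralZ/gcentralZ/gcentralM.
rewrite [gexp (_ + _)]taylor_expRD // -/(gexp _) -/(gexp _).
move: (taylor_gcentral expR cY) => {cY}; rewrite -/(gexp _).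
move: (gexp _) => Y cY.
rewrite (scaler_prod _ _ _ z) (scaler_prod _ _ _ z').
rewrite gcentral_regroup //; last exact: gcentral_prod.
rewrite prod_gcentralD1 // prod_gcentralD1 // prod_gcentralM //.
by rewrite [\prod_i (z i * z' i)]big1 ?mulr1.
Qed.

(** The real constant left by [exponentE] factors out of the exponential and,
  together with the scalar prefactors, makes up the mixing density at [z = 1]. *)
Lemma hyp_free_super (g : (I -> R) -> superfun R I) (u x y : I -> R) :
  zfield x y i0 * ginv (zfield x y p) * nu_super e W i0 g u x y
  * gexp (\sum_(q in edges e) W q.1 q.2 *: (hyp_dot x y q.1 q.2 + 1))
  * \prod_(i | i != p) ((2 * pi)^-1 *: ginv (zfield x y i))
  = nu1_density e W i0 u *: ((\prod_(i | i != p) (2 * pi)^-1) *: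
    (g u x y * gexp (- 2^-1 *: \sum_i \sum_j schroedinger W u i j *: free_dot x y i j))).
Proof.
rewrite /nu_super.
rewrite (nu_density_cancel _ _ _ (zfield_central x y) (ginv_zfield_central x y) (zfieldV x y)).
rewrite exponentE // /gexp taylor_expR_shift -/(gexp _) nu1_densityE.
by rewrite -scalerAr !scalerA; congr (_ *: _); ring.
Qed.

Lemma berezinD (a b : Lam) : berezin p (a + b) = berezin p a + berezin p b.
Proof.
rewrite -gbodyD /berezin; congr gbody.
by elim: (enum _) => //= i r ->; rewrite 2!gderD.
Qed.

Lemma berezinZ (l : R) (a : Lam) : berezin p (l *: a) = l * berezin p a.
Proof.
rewrite -gbodyZ /berezin; congr gbody.
by elim: (enum _) => //= i r ->; rewrite 2!gderZ.
Qed.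

Local Notation config := ((Defs.dim p).-tuple (measurableTypeR R)).

Lemma hyp_free_integrand (g : (I -> R) -> superfun R I) (u : I -> R)
    (t : config * config) :
  hyp_integrand p e W s (fun x y => ratio x y * nu_super e W i0 g u x y) t
  = free_integrand p (schroedinger W u) s (g u) t * nu1_density e W i0 u.
Proof.
rewrite /hyp_integrand /free_integrand /pin hyp_free_super gkillZ berezinZ.
by rewrite mulrC.
Qed.

Lemma pinE (F : superfun R I) (t : config * config) (S : {set I + I}) :
  pin p s F t S = if [disjoint S & [set inl p; inr p]%SET]
                  then F (extend p (sinh s) t.1) (extend p 0 t.2) S else 0.
Proof. by rewrite /pin ffunE. Qed.

(** Substitution at [p] is multiplicative, so that the hyperbolic integrand is a
  linear function of the pinned value of [F]. The weights [c] are independent of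
  [F], hence of [u] when [F] is a mixing density. *)
Lemma hyp_integrand_coef (h : superfun R I) (t : config * config) :
  exists c : {set I + I} -> R, forall F : superfun R I,
    hyp_integrand p e W s (fun x y => h x y * F x y) t
    = \sum_S pin p s F t S * c S.
Proof.
set x := extend p (sinh s) t.1; set y := extend p 0 t.2.
set P := [set inl p; inr p]%SET.
pose K := gexp (\sum_(q in edges e) W q.1 q.2 *: (hyp_dot x y q.1 q.2 + 1))
  * \prod_(i | i != p) ((2 * pi)^-1 *: ginv (zfield x y i)).
pose L (a : Lam) := berezin p (gkill P (h x y) * a * gkill P K).
have LP l a b : L (l *: a + b) = l * L a + L b.
  by rewrite /L mulrDr mulrDl -scalerAr -scalerAl berezinD berezinZ.
exists (fun S => L [ffun T : {set I + I} => (T == S)%:R]) => F.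
rewrite -(linear_gcoef LP) /L -!gkillM.
by rewrite /hyp_integrand {1}/pin -/x -/y -/P -!mulrA.
Qed.

Local Notation leb0 := (lebesgue_tuple R (Defs.dim i0)).

(** A finite linear combination of coefficients commutes with the integral over
  [u]. Coefficients meeting the generators at [p] vanish once pinned, so that
  only the pinned ones have to be integrable. *)
Lemma hyp_integrand_mixed (h : superfun R I) (g : (I -> R) -> superfun R I)
    (t : config * config) :
  (forall S : {set I + I}, leb0.-integrable setT
     (fun r => (pin p s (nu_super e W i0 g (extend i0 0 r)) t S)%:E)) ->
  hyp_integrand p e W s (fun x y => h x y * mixed e W i0 g x y) t
  = \int[leb0]_r hyp_integrand p e W s
      (fun x y => h x y * nu_super e W i0 g (extend i0 0 r) x y) t.
Proof.
move=> int; have [c cE] := hyp_integrand_coef h t.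
rewrite cE; under eq_Rintegral do rewrite cE.
rewrite Rintegral_sum; last first.
  move=> S; have := integrableZr measurableT (c S) (int S).
  by apply: eq_integrable => // r _ /=; rewrite EFinM.
apply: eq_bigr => S _; rewrite RintegralZr; last 2 first.
- by [].
- exact: int.
congr (_ * _); rewrite pinE; case: ifP => dS.
  by rewrite ffunE; apply: eq_Rintegral => r _; rewrite pinE dS.
rewrite -[LHS](Rintegral_0 leb0).
by apply: eq_Rintegral => r _; rewrite pinE dS.
Qed.

(** Both sides are iterated integrals of the same function of the field and of
  [u], in the two orders. *)
Lemma mixing_identity (g : (I -> R) -> superfun R I) :
  hyp_exists e W p i0 s ratio g -> free_exists e W p i0 s g ->
  hyp_bracket p e W s (fun x y => ratio x y * mixed e W i0 g x y)
  = free_mixed e W p i0 s g.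
Proof.
move=> [iS _] iF; rewrite /hyp_bracket /free_mixed /=.
pose H (q : (config * config) * (Defs.dim i0).-tuple (measurableTypeR R)) : R :=
  let u := extend i0 0 q.2 in
  free_integrand p (schroedinger W u) s (g u) q.1 * nu1_density e W i0 u.
apply: (@Fubini_Rintegral _ _ _ _ _ (leb2 p) leb0 H); first exact: iF.
  apply: filterS iS => t iSt; rewrite hyp_integrand_mixed //.
  by apply: eq_Rintegral => r _; rewrite hyp_free_integrand.
apply: filterS (ae_integrable2 iF) => r; rewrite /H /=.
set u := extend i0 0 r => iu.
(* The free integrand is known to be integrable only after multiplication by the
   density, which is divided out when it is not zero. *)
have [nu0|nu0] := eqVneq (nu1_density e W i0 u) 0.
  rewrite nu0 mulr0 -[LHS](Rintegral_0 (leb2 p)).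
  by apply: eq_Rintegral => t _; rewrite mulr0.
rewrite -RintegralZr //.
have := integrableZr measurableT (nu1_density e W i0 u)^-1 iu.
by apply: eq_integrable => // t _ /=; rewrite -EFinM mulfK.
Qed.

End ChangeOfMeasure.

Theorem theorem1 (R : realType) (V : finType)
  (e : rel V) (W : V -> V -> R) (h : V -> R)
  (e_sym : symmetric e) (e_irr : irreflexive e)
  (e_conn : forall i j, connect e i j)
  (W_sym : forall i j, W i j = W j i)
  (W_gt0 : forall i j, e i j -> 0 < W i j)
  (W_eq0 : forall i j, ~~ e i j -> W i j = 0)
  (h_ge0 : forall i, 0 <= h i) (h_gt0 : exists i, 0 < h i)
  (a : option V) (b : V) (s : R) :
  let e' := ext_adj e h in
  let W' := ext_weight W h in
  let delta : option V := None in
  (forall g : (option V -> R) -> superfun R (option V),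
    (forall u, smooth_superfun (g u)) ->
    let ratio : superfun R (option V) :=
      fun x y => zfield x y a * ginv (zfield x y delta) in
    hyp_exists e' W' delta a s ratio g -> free_exists e' W' delta a s g ->
    hyp_bracket delta e' W' s (fun x y => ratio x y * mixed e' W' a g x y)
    = free_mixed e' W' delta a s g)
  /\
  (forall g : (V -> R) -> superfun R V,
    (forall u, smooth_superfun (g u)) ->
    hyp_exists e W b b s (fun _ _ => 1) g -> free_exists e W b b s g ->
    hyp_bracket b e W s (mixed e W b g) = free_mixed e W b b s g).
Proof.
move=> e' W' delta.
have e'_sym : symmetric e' by move=> [i|] [j|] //=; exact: e_sym.
have W'_sym i j : W' i j = W' j i by case: i j => [i|] [j|] //=; exact: W_sym.
have W'_eq0 i j : ~~ e' i j -> W' i j = 0.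
  have h_eq0 k : ~~ (0 < h k) -> h k = 0.
    by rewrite -leNgt => hk; apply/eqP; rewrite eq_le hk h_ge0.
  by case: i j => [i|] [j|] //=; [exact: W_eq0|exact: h_eq0|exact: h_eq0].
split=> g _; first by move=> ratio; exact: mixing_identity.
(* With [i0 = p = b] the ratio of the first identity is [1]. *)
have one_ratio : (fun _ _ => 1) =
    (fun x y => zfield x y b * ginv (zfield x y b)) :> superfun R V.
  by apply/funext => x; apply/funext => y; rewrite zfieldV.
rewrite one_ratio => ex_hyp ex_free.
rewrite -(mixing_identity e_sym W_sym W_eq0 ex_hyp ex_free); congr hyp_bracket.
by apply/funext => x; apply/funext => y; rewrite zfieldV mul1r.
Qed.
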